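(* Let $\vartheta$ be a constant length random substitution over a finite alphabet $\mathcal{A}$ for which the following hold: (i) for all $a\in\mathcal{A}$ with $\#\vartheta(a)\ge 2$ and all permissible letter frequency vectors $\nu$ for $\vartheta$, we have $\nu_a=0$; (ii) there exist a letter $b\in\mathcal{A}$ with $\#\vartheta(b)\ge 2$ and a realisation $v\in\vartheta(b)$ with $|v|_b\ge 2$. Then the associated subshift $X_\vartheta$ has intermediate growth complexity function.
   Context: Let $\mathcal{A}$ be a finite alphabet, $\mathcal{A}^+$ the set of non-empty finite words over $\mathcal{A}$; $|u|$ is the length of $u$ and $|u|_a$ the number of occurrences of the letter $a$ in $u$. A random substitution over $\mathcal{A}$ is a map $\vartheta$ assigning to each letter $a\in\mathcal{A}$ a non-empty finite set $\vartheta(a)\subset\mathcal{A}^+$ of realisations (together with a choice of strictly positive probabilities on each $\vartheta(a)$, which plays no role here and is ignored). It is of constant length if there is an integer $\ell\ge 2$ such that $|v|=\ell$ for all $a\in\mathcal{A}$ and $v\in\vartheta(a)$. For a word $u=u_1\cdots u_n$, $\vartheta(u)=\{w_1\cdots w_n : w_i\in\vartheta(u_i)\}$; powers are defined by $\vartheta^1=\vartheta$ and $\vartheta^k(a)=\bigcup_{v\in\vartheta^{k-1}(a)}\vartheta(v)$. A word is $\vartheta$-legal if it is a (contiguous) subword of some word in $\vartheta^k(a)$ for some $k\in\mathbb{N}$, $a\in\mathcal{A}$; $\mathcal{L}_\vartheta$ is the set of legal words. The subshift of $\vartheta$ is $X_\vartheta=\{w\in\mathcal{A}^{\mathbb{Z}}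 : \text{every finite subword of } w \text{ lies in } \mathcal{L}_\vartheta\}$ with the left shift. $\mathcal{L}(X_\vartheta)$ is the set of finite words occurring in elements of $X_\vartheta$. No primitivity is assumed. A vector $\nu=(\nu_a)_{a\in\mathcal{A}}\in[0,1]^{\#\mathcal{A}}$ is a permissible letter frequency vector for $\vartheta$ if there exist a letter $b\in\mathcal{A}\cap\mathcal{L}(X_\vartheta)$, a sequence of positive integers $(n_k)_k$ with $n_k\to\infty$, and words $v^k\in\vartheta^{n_k}(b)$ such that $|v^k|_a/|v^k|\to\nu_a$ as $k\to\infty$ for all $a\in\mathcal{A}$. The complexity function $p_X(n)$ is the number of distinct words of length $n$ occurring in elements of $X$. It has intermediate growth if it grows faster than any polynomial ($p_X(n)/n^d\to\infty$ as $n\to\infty$ for every $d\in\mathbb{N}$) and sub-exponentially ($\frac1n\log p_X(n)\to 0$ as $n\to\infty$). *)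

(* Defs.v *)
From mathcomp Require Import all_boot all_order all_algebra finmap.
From mathcomp Require Import all_classical all_reals all_analysis.

Set Implicit Arguments.
Unset Strict Implicit.
Unset Printing Implicit Defensive.

Import Order.TTheory GRing.Theory Num.Theory.
Import numFieldNormedType.Exports.

Local Open Scope classical_set_scope.
Local Open Scope fset_scope.
Local Open Scope ring_scope.

(* The probabilities attached to the realisations are omitted: none of the
   notions below depends on them. *)
Record random_substitution (A : finType) := RandomSubstitution {
  realisations :> A -> {fset seq A};
  realisations_neq0 : forall a, realisations a != fset0;
  realisations_nonnil : forall a v, v \in realisations a -> v != [::]
}.

Section RandomSubstitution.
Variables (A : finType) (theta : random_substitution A).

Definition constant_length : Prop :=
  exists2 l : nat, (2 <= l)%N &
    forall (a : A) (v : seq A), v \in theta a -> size v = l.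

(* [all2] also forces [ws] and [u] to have the same size. *)
Definition subst_word (u : seq A) : set (seq A) :=
  [set w | exists2 ws : seq (seq A),
     all2 (fun wi ui => wi \in theta ui) ws u & w = flatten ws].

(* Only the exponents k >= 1 are used; the value at 0 is a convention. *)
Fixpoint subst_pow (k : nat) (a : A) : set (seq A) :=
  match k with
  | 0 => [set [:: a]]
  | 1 => [set v | v \in theta a]
  | k'.+1 => \bigcup_(v in subst_pow k' a) subst_word v
  end.

Definition legal : set (seq A) :=
  [set u | exists k a v, [/\ (0 < k)%N, subst_pow k a v & infix u v]].

End RandomSubstitution.

Section Subshift.
Variable A : finType.

Definition subword (w : int -> A) (i : int) (n : nat) : seq A :=
  [seq w (i + j%:Z) | j <- iota 0 n].

Definition subshift (theta : random_substitution A) : set (int -> A) :=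
  [set w | forall i n, legal theta (subword w i n)].

Definition language (X : set (int -> A)) : set (seq A) :=
  [set u | exists2 w, X w & exists i, subword w i (size u) = u].

Definition complexity (X : set (int -> A)) (n : nat) : nat :=
  #|[pred t : n.-tuple A | `[< language X t >]]|.

End Subshift.

Definition permissible (R : realType) (A : finType)
    (theta : random_substitution A) (nu : A -> R) : Prop :=
  (forall a, 0 <= nu a <= 1) /\
  exists (b : A) (n : nat -> nat) (v : nat -> seq A),
    [/\ language (subshift theta) [:: b],
        (forall k, (0 < n k)%N) /\ n k @[k --> \oo] --> \oo,
        forall k, subst_pow theta (n k) b (v k) &
        forall a, (count_mem a (v k))%:R / (size (v k))%:R
                    @[k --> \oo] --> nu a].

Definition intermediate_growth (R : realType) (p : nat -> nat) : Prop :=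
  (forall d : nat, (p n)%:R / n%:R ^+ d @[n --> \oo] --> (+oo : set_system R))
  /\ (ln ((p n)%:R : R) / n%:R @[n --> \oo] --> (0 : R)).

(* Main.v *)
(* Lower bound: if the random letter b has a realisation containing b twice, then
   theta^k(b) contains a word with at least 2^k occurrences of b, and substituting
   these independently gives at least 2^(2^k) words of length l^(k+1); with
   n ~ l^k this beats every power of n.

   Upper bound: a word of length n <= l^k of the subshift sits inside a product of
   two words of theta^k(a), theta^k(c), with a, c letters of the subshift, so it is
   enough to bound the number M_k of words in these sets.  By Bolzano-Weierstrass,
   hypothesis (i) says that the proportion of random letters in words of theta^k(a)
   tends to 0 uniformly, and M_(k+1) <= M_k * C^m, where m is the maximal number of
   random letters in such a word, so log M_k = o(l^k). *)
Require Import Defs.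
From mathcomp Require Import all_boot all_order all_algebra finmap.
From mathcomp Require Import all_classical all_reals all_analysis.
From mathcomp Require Import zify lra ring.

Set Implicit Arguments.
Unset Strict Implicit.
Unset Printing Implicit Defensive.

Import Order.TTheory GRing.Theory Num.Theory.
Import numFieldNormedType.Exports.

(** * Iterated images of words *)

Section Images.
Variables (A : finType) (theta : random_substitution A).
Implicit Types (a b : A) (s t u v w : seq A) (k m n : nat).

(** One entry per choice of realisations, so that the length of the list counts choices;
    [subst_wordE] identifies its members with [subst_word]. *)
Fixpoint images u : seq (seq A) :=
  if u is a :: u' then [seq x ++ y | x <- theta a, y <- images u']
  else [:: [::]].

Fixpoint images_iter k u : seq (seq A) :=
  if k is k'.+1 then flatten [seq images v | v <- images_iter k' u]
  else [:: u].

Lemma images_iterS k u v :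
  reflect (exists2 w, w \in images_iter k u & v \in images w)
          (v \in images_iter k.+1 u).
Proof. exact: flatten_mapP. Qed.

Lemma images_cat s t v :
  v \in images (s ++ t) <->
  exists x y, [/\ x \in images s, y \in images t & v = x ++ y].
Proof.
elim: s v => [|a s IHs] v /=.
  split=> [vt|[x [y [+ yt ->]]]]; first by exists [::], v; rewrite inE.
  by rewrite inE => /eqP ->.
split.
  case/allpairsP => -[x z] /= [xa /IHs[y [y' [ys yt ->]]] ->].
  exists (x ++ y), y'; rewrite catA; split => //.
  by apply/allpairsP; exists (x, y).
case=> x [y [/allpairsP[[x1 x2] /= [x1a x2s ->]] yt ->]].
rewrite -catA; apply/allpairsP; exists (x1, x2 ++ y); split => //=.
by apply/IHs; exists x2, y.
Qed.

Lemma images_iter_cat k s t v :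
  v \in images_iter k (s ++ t) <->
  exists x y, [/\ x \in images_iter k s, y \in images_iter k t & v = x ++ y].
Proof.
elim: k v => [|k IHk] v.
  rewrite inE; split=> [/eqP ->|[x [y [+ + ->]]]]; last by rewrite !inE => /eqP-> /eqP->.
  by exists s, t; rewrite !inE.
split.
  case/images_iterS => w /IHk[x [y [xs yt ->]]] /images_cat[x' [y' [x'x y'y ->]]].
  by exists x', y'; split => //; apply/images_iterS; [exists x|exists y].
case=> x' [y' [/images_iterS[x xs xx'] /images_iterS[y yt yy'] ->]].
apply/images_iterS; exists (x ++ y); first by apply/IHk; exists x, y.
by apply/images_cat; exists x', y'.
Qed.

Lemma images_iterD m k u v :
  v \in images_iter (m + k) u <->
  exists2 w, w \in images_iter k u & v \in images_iter m w.
Proof.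
elim: m v => [|m IHm] v.
  by split=> [vu|[w wu]]; [exists v; rewrite ?inE|rewrite inE => /eqP ->].
rewrite addSn; split.
  case/images_iterS => w /IHm[w' w'u ww'] vw; exists w' => //.
  by apply/images_iterS; exists w.
case=> w wu /images_iterS[w' w'w vw']; apply/images_iterS; exists w' => //.
by apply/IHm; exists w.
Qed.

Lemma has_realisation a : exists v, v \in theta a.
Proof. exact/fset0Pn/realisations_neq0. Qed.

Lemma has_image u : exists v, v \in images u.
Proof.
elim: u => [|a u [y yu]]; first by exists [::]; rewrite inE.
have [x xa] := has_realisation a.
by exists (x ++ y); apply/allpairsP; exists (x, y).
Qed.

Lemma has_image_iter k u : exists v, v \in images_iter k u.
Proof.
elim: k => [|k [w wu]]; first by exists u; rewrite inE.
by have [v vw] := has_image w; exists v; apply/images_iterS; exists w.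
Qed.

Lemma images1 a : images [:: a] =i theta a.
Proof.
move=> v; apply/allpairsP/idP => [[[x y] /= [xa + ->]]|va].
  by rewrite inE => /eqP ->; rewrite cats0.
by exists (v, [::]); rewrite cats0.
Qed.

Lemma subst_wordE u v : subst_word theta u v <-> v \in images u.
Proof.
elim: u v => [|a u IHu] v.
  rewrite inE; split=> [[[|w ws] //= _ ->//]|/eqP ->].
  by exists [::].
split=> [[[|w ws] //= /andP[wa wsu] ->]|].
  by apply/allpairsP; exists (w, flatten ws); split => //; apply/IHu; exists ws.
case/allpairsP => -[x y] /= [xa /IHu[ws wsu ->] ->].
by exists (x :: ws) => //=; rewrite xa.
Qed.

Lemma subst_powE k a v : subst_pow theta k a v <-> v \in images_iter k [:: a].
Proof.
elim: k v => [|[|k] IHk] v; first by rewrite inE; split=> /eqP.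
  split=> [va|/images_iterS[w]].
    by apply/images_iterS; exists [:: a]; rewrite ?inE ?images1.
  by rewrite inE => /eqP ->; rewrite images1.
split=> [[w /IHk wa /subst_wordE vw]|/images_iterS[w /IHk wa /subst_wordE vw]].
  by apply/images_iterS; exists w.
by exists w.
Qed.

Lemma legalE u :
  legal theta u <-> exists k a v, v \in images_iter k.+1 [:: a] /\ infix u v.
Proof.
split=> [[[|k] [a [v [// _ /subst_powE va uv]]]]|[k [a [v [va uv]]]]].
  by exists k, a, v.
by exists k.+1, a, v; split => //; apply/subst_powE.
Qed.

Lemma legal_infix u v : infix u v -> legal theta v -> legal theta u.
Proof.
move=> uv [k [a [w [k0 aw vw]]]]; exists k, a, w; split => //.
exact: infix_trans vw.
Qed.

Section ConstantLength.
Variable l : nat.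
Hypothesis size_realisation : forall a v, v \in theta a -> size v = l.

Lemma size_mem_images u v : v \in images u -> size v = l * size u.
Proof.
elim: u v => [|a u IHu] v; first by rewrite inE => /eqP ->; rewrite muln0.
case/allpairsP => -[x y] /= [/size_realisation xa /IHu yu ->].
by rewrite size_cat xa yu mulnS.
Qed.

Lemma size_mem_images_iter k u v : v \in images_iter k u -> size v = l ^ k * size u.
Proof.
elim: k v => [|k IHk] v; first by rewrite inE => /eqP ->; rewrite mul1n.
by case/images_iterS => w /IHk sw /size_mem_images ->; rewrite sw mulnA expnS.
Qed.

(** Realisations share the length [l], so a concatenation can be cut back into its blocks and
    different choices give different words. *)
Lemma images_uniq u : uniq (images u).
Proof.
elim: u => //= a u IHu; apply: allpairs_uniq => //; first exact: fset_uniq.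
move=> _ _ /allpairsP[[x y] /= [xa _ ->]] /allpairsP[[x' y'] /= [xa' _ ->]] /= /eqP.
rewrite eqseq_cat ?(size_realisation xa) ?(size_realisation xa') //.
by case/andP => /eqP -> /eqP ->.
Qed.

End ConstantLength.

Lemma size_images u : size (images u) = \prod_(a <- u) #|` theta a|.
Proof.
elim: u => [|a u IHu]; first by rewrite big_nil.
by rewrite big_cons /= size_allpairs IHu cardfE.
Qed.

End Images.

(** * The language of the subshift *)

Section Language.
Variables (A : finType) (theta : random_substitution A).
Implicit Types (a b : A) (s t u v : seq A) (k m n N : nat) (w : int -> A).

(** A finitary form of membership in the language of the subshift; the equivalence is
    [extendable_language] and [language_extendable]. *)
Definition extendable u := forall N, exists x y,
  [/\ size x = N, size y = N & legal theta (x ++ u ++ y)].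

Lemma extendable_geq u :
  (forall N, exists x y, [/\ N <= size x, N <= size y & legal theta (x ++ u ++ y)]) ->
  extendable u.
Proof.
move=> + N => /(_ N)[x [y [Nx Ny xuy]]].
exists (drop (size x - N) x), (take N y); rewrite size_drop size_takel ?subKn //.
split => //; apply: legal_infix xuy; apply/infixP.
exists (take (size x - N) x), (drop N y).
by rewrite -!catA cat_take_drop [RHS]catA cat_take_drop.
Qed.

(** If every index failed beyond some context length of its own, the maximum of these finitely many
    lengths would contradict the assumption. [Q] carries along information that must hold for the
    chosen index. *)
Lemma extendable_pigeonhole (T : finType) (f : T -> seq A) (Q : T -> Prop) :
  (forall N, exists i x y, [/\ N <= size x, N <= size y,
     legal theta (x ++ f i ++ y) & Q i]) ->
  exists2 i, extendable (f i) & Q i.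
Proof.
move=> ext; apply: contrapT => no_ext.
have /choice[N illegalN] : forall i, exists N, forall x y,
    N <= size x -> N <= size y -> legal theta (x ++ f i ++ y) -> ~ Q i.
  move=> i; apply: contrapT => noN; apply: no_ext; exists i.
    apply: extendable_geq => N; apply: contrapT => no_xy; apply: noN.
    by exists N => x y Nx Ny xiy Qi; apply: no_xy; exists x, y.
  (* An index violating [Q] fails at every length, so the bound 0 serves. *)
  apply: contrapT => nQi; apply: noN.
  by exists 0 => x y _ _ _ Qi; apply: nQi.
have [i [x [y [Nx Ny xiy Qi]]]] := ext (\max_i N i).
by apply: (illegalN i x y) => //; [apply: leq_trans Nx|apply: leq_trans Ny];
  exact: leq_bigmax.
Qed.

(** The step of König's lemma: among the finitely many pairs of letters around [u], one pair occurs
    within arbitrarily long contexts. *)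
Lemma extendable_grow u : extendable u -> exists a c, extendable (a :: rcons u c).
Proof.
move=> ext_u.
have [|[a c] ext_auc _] := @extendable_pigeonhole (A * A)%type
    (fun p => p.1 :: rcons u p.2) (fun=> True).
  move=> N; have [x [y [+ + xuy]]] := ext_u N.+1.
  case/lastP: x xuy => // x a; case: y => // c y xuy; rewrite size_rcons /=.
  move=> [sx] [sy]; exists (a, c), x, y; rewrite sx sy; split => //=.
  by rewrite cat_rcons; rewrite cat_rcons in xuy.
by exists a, c.
Qed.

Lemma extendable_tower u : extendable u ->
  exists f : nat -> seq A, [/\ f 0 = u, forall n, legal theta (f n) &
    forall n, exists a c, f n.+1 = a :: rcons (f n) c].
Proof.
move=> ext_u.
pose R (s t : {s | extendable s}) := exists a c, sval t = a :: rcons (sval s) c.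
have [|f [f0 fS]] := @dependent_choice _ R _ (exist _ _ ext_u).
  move=> [s ext_s]; apply: cid; have [a [c ext_asc]] := extendable_grow ext_s.
  by exists (exist _ _ ext_asc), a, c.
exists (sval \o f); split=> [|n|//]; first by rewrite /= f0.
have [x [y [/size0nil -> /size0nil -> /=]]] := proj2_sig (f n) 0.
by rewrite cats0.
Qed.

Lemma size_subword w i n : size (subword w i n) = n.
Proof. by rewrite size_map size_iota. Qed.

Lemma nth_subword d w i n j : j < n -> nth d (subword w i n) j = w (i + j%:Z)%R.
Proof. by move=> jn; rewrite (nth_map 0) ?size_iota // nth_iota. Qed.

Lemma subwordD w i m n :
  subword w i (m + n) = subword w i m ++ subword w (i + m%:Z)%R n.
Proof.
rewrite /subword iotaD map_cat add0n -[m in iota m n]addn0 iotaDl -map_comp.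
by congr (_ ++ _); apply: eq_map => j /=; rewrite PoszD addrA.
Qed.

Lemma extendable_language u :
  extendable u -> language (subshift theta) u.
Proof.
move=> /[dup] ext_u /extendable_tower[f [f0 legal_f fS]].
(* Any letter will do as the default value of [nth]; [u] itself may be empty. *)
have [d _] := fS 0.
have sizef n : size (f n) = size u + n.*2.
  elim: n => [|n IHn]; first by rewrite f0 addn0.
  by have [a [c ->]] := fS n; rewrite /= size_rcons IHn doubleS !addnS.
have nthf n m i : i < size (f n) -> nth d (f (m + n)) (m + i) = nth d (f n) i.
  move=> i_lt; elim: m => //= m <-; have [a [c ->]] := fS (m + n).
  rewrite /= nth_rcons; case: ltnP => //; move: i_lt; rewrite !sizef; lia.
(* In [f n] the word [u] starts at position [n], so coordinate [i] of the limit sits at position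
   [i + n]. Level [|i| + 1] is deep enough to contain it, and deeper levels agree by [nthf]. *)
pose w (i : int) := nth d (f `|i|.+1) (absz (i + `|i|%N.+1%:Z)%R).
have wE m (i : int) : `|i| < m -> w i = nth d (f m) (absz (i + m%:Z)%R).
  move=> im; rewrite /w -(@nthf _ (m - `|i|.+1)) ?sizef; last by lia.
  by congr (nth d (f _) _); lia.
exists w => [i n|].
  apply: (@legal_infix _ _ _ (f (`|i| + n).+1)) => //.
  suff -> : subword w i n =
      take n (drop (absz (i + (`|i|%N + n).+1%:Z)%R) (f (`|i| + n).+1)).
    by apply: infix_trans (infix_drop _ _) ; exact: infix_take.
  apply: (@eq_from_nth _ d).
    by rewrite size_subword size_takel // size_drop sizef; lia.
  rewrite size_subword => j jn; rewrite nth_subword // nth_take // nth_drop.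
  by rewrite (wE (`|i| + n).+1); [congr nth|]; lia.
exists 0%R; apply: (@eq_from_nth _ d); rewrite size_subword // => j jn.
rewrite nth_subword // add0r (wE j.+1) //= -[in RHS]f0 -(@nthf 0 j.+1) ?f0 //.
by rewrite addn0 addnC.
Qed.

Lemma language_extendable u :
  language (subshift theta) u -> extendable u.
Proof.
move=> [w wX [i <-]] N; set n := size u.
exists (subword w (i - N%:Z)%R N), (subword w (i + n%:Z)%R N).
rewrite !size_subword; split => //.
by have := wX (i - N%:Z)%R (N + (n + N)); rewrite !subwordD subrK.
Qed.

Lemma extendable_infix u v : infix u v -> extendable v -> extendable u.
Proof.
move=> /infixP[s [t ->]] ext_v; apply: extendable_geq => N.
have [x [y [sx sy xvy]]] := ext_v N; exists (x ++ s), (t ++ y).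
rewrite !size_cat sx sy leq_addr leq_addl; split => //.
by move: xvy; rewrite !catA.
Qed.

(** * Extendable words under a substitution of constant length *)

Section ConstantLength.
Variable l : nat.
Hypotheses (l_gt1 : 1 < l)
  (size_realisation : forall a v, v \in theta a -> size v = l).
Let size_iter := size_mem_images_iter size_realisation.

(** Substituting the whole legal context along with [u] multiplies the lengths of both sides by
    [l ^ k], so neither side gets shorter. *)
Lemma extendable_image_iter k u v :
  extendable u -> v \in images_iter theta k u -> extendable v.
Proof.
move=> ext_u vu; apply: extendable_geq => N.
have [x [y [sx sy /legalE[j [a [z [za /infixP[s [t zE]]]]]]]]] := ext_u N.
have [s' s's] := has_image_iter theta k s.
have [x' x'x] := has_image_iter theta k x.
have [y' y'y] := has_image_iter theta k y.
have [t' t't] := has_image_iter theta k t.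
exists x', y'; rewrite (size_iter x'x) (size_iter y'y) sx sy.
rewrite !leq_pmull ?expn_gt0 ?(ltnW l_gt1) //; split => //.
apply/legalE; exists (k + j), a, (s' ++ (x' ++ v ++ y') ++ t').
split; last exact: infix_infix.
rewrite -addnS; apply/images_iterD; exists z => //; rewrite zE.
apply/images_iter_cat; exists s', ((x' ++ v ++ y') ++ t'); split => //.
apply/images_iter_cat; exists (x' ++ v ++ y'), t'; split => //.
apply/images_iter_cat; exists x', (v ++ y'); split => //.
by apply/images_iter_cat; exists v, y'.
Qed.

Lemma count_mem_gt1 b v :
  1 < count_mem b v -> exists x y z, v = x ++ b :: y ++ b :: z.
Proof.
move=> count_v; have b_v : b \in v by rewrite -has_pred1 has_count; lia.
case/splitPr: b_v count_v => x z; rewrite count_cat /= eqxx.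
case: (boolP (b \in x)) => [/splitPr[x' y] _|/count_memPn -> count_z].
  by exists x', y, z; rewrite -catA.
have /splitPr[y z'] : b \in z by rewrite -has_pred1 has_count -ltnS.
by exists x, y, z'.
Qed.

(* With [v = x b y b z], descending alternately into the second and the first
   displayed [b] pushes both ends of the image away from a marked [b]. *)
Lemma extendable_repeated b v :
  v \in theta b -> 1 < count_mem b v -> extendable [:: b].
Proof.
move=> vb /count_mem_gt1[x [y [z v_eq]]]; rewrite {}v_eq in vb.
have subst_b k s t : s ++ [:: b] ++ t \in images_iter theta k [:: b] ->
    exists s' t', [/\ size s <= size s', size t <= size t' &
      s' ++ (x ++ b :: y ++ b :: z) ++ t' \in images_iter theta k.+1 [:: b]].
  move=> stb; have [s' s's] := has_image theta s; have [t' t't] := has_image theta t.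
  exists s', t'; rewrite (size_mem_images size_realisation s's).
  rewrite (size_mem_images size_realisation t't) !leq_pmull ?(ltnW l_gt1) //; split => //.
  apply/images_iterS; exists (s ++ [:: b] ++ t) => //.
  apply/images_cat; exists s', ((x ++ b :: y ++ b :: z) ++ t'); split => //.
  by apply/images_cat; exists (x ++ b :: y ++ b :: z), t'; rewrite images1.
have ext N : exists k s t, [/\ N <= size s, N <= size t &
    s ++ [:: b] ++ t \in images_iter theta k.+1 [:: b]].
  elim: N => [|N [k [s [t [Ns Nt /subst_b[s' [t' [ss' tt' stb]]]]]]]].
    exists 0, x, (y ++ b :: z); split => //.
    by apply/images_iterS; exists [:: b]; rewrite ?inE ?images1.
  have /subst_b[s2 [t2 [ss2 tt2 stb2]]] :
      (s' ++ x ++ b :: y) ++ [:: b] ++ (z ++ t')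
        \in images_iter theta k.+2 [:: b].
    by move: stb; rewrite !(=^~ catA, cat_cons).
  exists k.+2, (s2 ++ x), ((y ++ b :: z) ++ t2).
  rewrite !size_cat /= in ss2 tt2 *; split; [lia..|].
  by move: stb2; rewrite !(=^~ catA, cat_cons).
apply: extendable_geq => N; have [k [s [t [Ns Nt stb]]]] := ext N.
exists s, t; split => //; apply/legalE; exists k, b, (s ++ [:: b] ++ t).
by split => //; exact: infix_refl.
Qed.

End ConstantLength.
End Language.

(** * Counting words *)

Section Complexity.
Variables (A : finType) (X : set (int -> A)).
Implicit Types (u : seq A) (ws : seq (seq A)) (m n : nat).

Let words n : seq (seq A) :=
  [seq val t | t <- enum [pred t : n.-tuple A | `[< language X t >]]].

Let mem_words n u : u \in words n <-> language X u /\ size u = n.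
Proof.
split=> [/mapP[t + ->]|[Xu su]].
  by rewrite mem_enum inE => Xt; split => //; exact: size_tuple.
apply/mapP; exists (tcast su (in_tuple u)); last by rewrite /= val_tcast.
by rewrite mem_enum inE /= val_tcast.
Qed.

Let size_words n : size (words n) = complexity X n.
Proof. by rewrite size_map -cardE. Qed.

Let words_uniq n : uniq (words n).
Proof. by rewrite map_inj_uniq ?enum_uniq //; exact: val_inj. Qed.

Lemma complexity_geq n ws : uniq ws ->
  (forall u, u \in ws -> language X u /\ size u = n) -> size ws <= complexity X n.
Proof.
move=> ws_uniq Xws; rewrite -size_words; apply: uniq_leq_size => // u.
by move=> /Xws /mem_words.
Qed.

Lemma complexity_leq n ws :
  (forall u, language X u -> size u = n -> u \in ws) -> complexity X n <= size ws.
Proof.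
move=> Xws; rewrite -size_words; apply: uniq_leq_size => // u.
by case/mem_words; exact: Xws.
Qed.

(** Every occurrence extends to the right, so taking prefixes maps the words of length [n] onto
    those of length [m]. *)
Lemma leq_complexity m n : m <= n -> complexity X m <= complexity X n.
Proof.
move=> mn; rewrite -[leqRHS]size_words -[leqRHS](size_map (take m)).
apply: complexity_leq => u [w Xw [i <-]] sw; apply/mapP.
exists (subword w i n).
  by apply/mem_words; split; [exists w => //; exists i|]; rewrite size_subword.
by rewrite size_subword in sw; rewrite sw -(subnKC mn) subwordD take_size_cat // size_subword.
Qed.

End Complexity.

(** * Complexity bounds: independent choices from below, pairs of supertiles from above *)

Section Counting.
Variables (A : finType) (theta : random_substitution A).
Implicit Types (a b : A) (s t u v : seq A) (k m n N : nat).
Variable l : nat.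
Hypotheses (l_gt1 : 1 < l)
  (size_realisation : forall a v, v \in theta a -> size v = l).

Let size_iter := size_mem_images_iter size_realisation.
Let expl_gt0 k : 0 < l ^ k. Proof. by rewrite expn_gt0 ltnW. Qed.

Definition is_random a := 1 < #|` theta a|.

Lemma card_realisations_gt0 a : 0 < #|` theta a|.
Proof. by rewrite cardfs_gt0 realisations_neq0. Qed.

Lemma size_images_ge b u : is_random b -> 2 ^ count_mem b u <= size (images theta u).
Proof.
move=> b_random; rewrite size_images; elim: u => [|a u IHu]; first by rewrite big_nil.
rewrite big_cons /= expnD leq_mul //.
by case: eqP => [->//|_]; exact: card_realisations_gt0.
Qed.

(** Only random letters contribute a factor above 1. The successor keeps the base positive in all
    cases. *)
Lemma size_images_le u :
  size (images theta u) <= (\max_a #|` theta a|).+1 ^ count is_random u.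
Proof.
rewrite size_images; elim: u => [|a u IHu]; first by rewrite big_nil.
rewrite big_cons /= expnD leq_mul //; case: (ltnP 1 #|` theta a|) => [|a_det].
  by rewrite /is_random => -> /=; rewrite expn1 leqW //; exact: leq_bigmax.
by rewrite /is_random ltnNge a_det.
Qed.

(** Choose [v] for each [b] in [u] and any realisation for the other letters. *)
Lemma image_count_ge b v u : v \in theta b -> 1 < count_mem b v ->
  exists2 w, w \in images theta u & 2 * count_mem b u <= count_mem b w.
Proof.
move=> vb count_v; elim: u => [|a u [w wu count_w]]; first by exists [::]; rewrite ?inE.
have [x [xa count_x]] : exists x, x \in theta a /\ 2 * (a == b) <= count_mem b x.
  case: eqP => [->|_]; first by exists v.
  by have [x xa] := has_realisation theta a; exists x.
exists (x ++ w); first by apply/allpairsP; exists (x, w).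
by rewrite count_cat /= mulnDr leq_add.
Qed.

Lemma complexity_lower_bound b v k : is_random b -> v \in theta b ->
  1 < count_mem b v -> 2 ^ 2 ^ k <= complexity (subshift theta) (l ^ k.+1).
Proof.
move=> b_random vb count_v.
have [w wb count_w] :
    exists2 w, w \in images_iter theta k [:: b] & 2 ^ k <= count_mem b w.
  elim: k => [|k [u ub count_u]]; first by exists [:: b]; rewrite /= ?inE ?eqxx.
  have [w wu count_w] := image_count_ge u vb count_v.
  exists w; first by apply/images_iterS; exists u.
  by apply: leq_trans count_w; rewrite expnS leq_mul2l count_u orbT.
(* The images of the single word [w] suffice: they are pairwise distinct, and they lie in the
   language because [b] does. *)
apply: (@leq_trans (size (images theta w))).
  by apply: leq_trans (size_images_ge w b_random); rewrite leq_pexp2l.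
apply: complexity_geq => [|u uw]; first exact: (images_uniq size_realisation).
have ub : u \in images_iter theta k.+1 [:: b] by apply/images_iterS; exists w.
split; last by rewrite (size_iter ub) muln1.
apply: extendable_language; apply: (extendable_image_iter l_gt1 size_realisation) ub.
exact: (extendable_repeated l_gt1 size_realisation) vb count_v.
Qed.

(** Words of [theta^k(a)], starting only from letters of the subshift, since permissible frequency
    vectors concern only these. Repetitions in the list are harmless for upper bounds. *)
Fixpoint supertiles k : seq (seq A) :=
  if k is k'.+1 then flatten [seq images theta v | v <- supertiles k']
  else [seq [:: a] | a <- enum A & `[< language (subshift theta) [:: a] >]].

Lemma supertilesP k v : v \in supertiles k <->
  exists2 a, language (subshift theta) [:: a] & v \in images_iter theta k [:: a].
Proof.
elim: k v => [|k IHk] v.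
  split=> [/mapP[a]|[a Xa]].
    by rewrite mem_filter => /andP[/asboolP Xa _] ->; exists a; rewrite ?inE.
  by rewrite inE => /eqP ->; apply/map_f; rewrite mem_filter mem_enum andbT; apply/asboolP.
split=> [/flatten_mapP[w /IHk[a Xa wa] vw]|[a Xa /images_iterS[w wa vw]]].
  by exists a => //; apply/images_iterS; exists w.
by apply/flatten_mapP; exists w => //; apply/IHk; exists a.
Qed.

Lemma size_supertilesS k m :
  (forall v, v \in supertiles k -> count is_random v <= m) ->
  size (supertiles k.+1) <= size (supertiles k) * (\max_a #|` theta a|).+1 ^ m.
Proof.
move=> count_le /=; elim: (supertiles k) count_le => //= v s IHs count_le.
rewrite size_cat mulSn leq_add //.
  by apply: leq_trans (size_images_le v) _; rewrite leq_pexp2l ?count_le ?mem_head.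
by apply: IHs => w ws; apply: count_le; rewrite inE ws orbT.
Qed.

(** A long legal word around [u] is cut into blocks of length [l ^ k], of which two consecutive ones
    cover [u]. The pair of letters behind these blocks may vary with the context; the pigeonhole
    fixes one extendable pair, so that both letters belong to the subshift. *)
Lemma language_supertiles u k : language (subshift theta) u -> size u <= l ^ k ->
  exists i p q, [/\ i < l ^ k, p \in supertiles k, q \in supertiles k &
    u = take (size u) (drop i (p ++ q))].
Proof.
move=> /language_extendable ext_u u_le.
pose Q (ac : A * A) := exists i p q, [/\ i < l ^ k, p \in images_iter theta k [:: ac.1],
    q \in images_iter theta k [:: ac.2] & u = take (size u) (drop i (p ++ q))].
have [|[a c] /= ext_ac [i [p [q [i_lt pa qc uE]]]]] :=
    @extendable_pigeonhole _ theta (A * A)%type (fun ac => [:: ac.1; ac.2]) Q; last first.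
  exists i, p, q; split => //; apply/supertilesP; [exists a|exists c] => //;
  apply/extendable_language; apply: extendable_infix ext_ac;
  [exact: (prefix_infix [:: a] [:: c])|exact: (suffix_infix [:: a] [:: c])].
(* After division by [l ^ k] at least [N + 2] letters remain on each side; on the right, two of them
   are the pair itself. *)
move=> N; have [x [y [sx sy]]] := ext_u (l ^ k * N.+2).
move=> /legalE[j [d [v [vd /infixP[r [t vE]]]]]].
have sv : size v = size (r ++ x) + size u + l ^ k * N.+2 + size t.
  by rewrite vE !size_cat sy !addnA.
(* Since [v] is longer than [l ^ k], it splits into level-[k] blocks over a word [s] that is still a
   proper iterate, hence legal. *)
have k_lt : k < j.+1.
  rewrite -(@ltn_exp2l l) // -[X in _ < X]muln1 -(size_iter vd) sv size_cat sx.
  by have := leq_pmulr (l ^ k) (ltn0Sn N.+1); have := expl_gt0 k; lia.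
move: vd; rewrite -(subnKC (ltnW k_lt)) => /images_iterD[s sd vs].
(* [c] is the position of [u] in [v], [i] the index of the block where [u] starts; the remainder [e]
   below is the offset inside that block. *)
set c := size (r ++ x) in sv; pose i := c %/ l ^ k.
have i_le : N.+2 <= i by rewrite leq_divRL // /c size_cat sx mulnC; lia.
have cE := divn_eq c (l ^ k); rewrite -/i in cE.
have e_lt : c %% l ^ k < l ^ k by rewrite ltn_mod.
set e := c %% l ^ k in cE e_lt.
have s_ge : i + N.+2 <= size s.
  rewrite -(leq_pmul2l (expl_gt0 k)) -(size_iter vs) sv mulnDr.
  rewrite cE [l ^ k * i]mulnC; move: (l ^ k * N.+2) (i * l ^ k) => *; lia.
have i_size : i <= size s by exact: leq_trans (leq_addr _ _) s_ge.
have := cat_take_drop i s; have : N.+2 <= size (drop i s).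
  by rewrite size_drop leq_subRL.
case: (drop i s) => [|a [|b z]] //= sz sE.
move: vs; rewrite -sE -cat1s -[b :: z]cat1s.
case/images_iter_cat => v1 [_ [v1s /images_iter_cat[p [_ [pa
  /images_iter_cat[q [v2 [qb v2z ->]]] ->]]] v_eq]].
have sv1 : size v1 = i * l ^ k.
  by rewrite (size_iter v1s) size_takel 1?mulnC.
have [sp sq] : size p = l ^ k /\ size q = l ^ k.
  by rewrite (size_iter pa) (size_iter qb) muln1.
exists (a, b), (take i s), z; split => //=; [by rewrite size_takel // ltnW // ltnW| |].
  apply/legalE; exists (j.+1 - k).-1, d, s; rewrite prednK ?subn_gt0 //.
  by split => //; rewrite -[s in infix _ s]sE infix_refl.
exists e, p, q; split => //.
transitivity (take (size u) (drop c v)).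
  by rewrite vE -!catA catA drop_size_cat // take_size_cat.
rewrite v_eq [drop c _]drop_cat sv1 ltnNge cE leq_addr /= addKn catA.
rewrite [drop e (_ ++ v2)]drop_cat ifT ?takel_cat // ?size_drop size_cat sp sq; last by lia.
by rewrite leq_subRL; lia.
Qed.

Lemma complexity_upper_bound n k : n <= l ^ k ->
  complexity (subshift theta) n <= l ^ k * size (supertiles k) ^ 2.
Proof.
move=> n_le.
pose pairs := [seq p ++ q | p <- supertiles k, q <- supertiles k].
rewrite -[l ^ k](size_iota 0) -mulnn -(size_allpairs cat) -/pairs.
rewrite -(size_allpairs (fun i pq => take n (drop i pq))).
apply: complexity_leq => u Xu su; rewrite -su in n_le.
have [i [p [q [i_lt pk qk uE]]]] := language_supertiles Xu n_le.
apply/allpairsP; exists (i, p ++ q); rewrite mem_iota -su; split => //=.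
by apply/allpairsP; exists (p, q).
Qed.

End Counting.

(** * Growth *)

(** For [l ^ k.+1 <= n < l ^ k.+2], the bound [l <= 2 ^ l] makes [M * n ^ d] at most 2 to a power
    linear in [k], whereas [p n] is at least [2 ^ 2 ^ k]. *)
Lemma superpolynomial_of_double_exponential (p : nat -> nat) (l M d : nat) :
  1 < l -> {homo p : m n / m <= n} -> (forall k, 2 ^ 2 ^ k <= p (l ^ k.+1)) ->
  exists N, forall n, N <= n -> M * n ^ d <= p n.
Proof.
move=> l_gt1 p_mono p_ge.
have expn_ge_linear c : exists K, forall k, K <= k -> c * k.+1 <= 2 ^ k.
  (* At this start the claim reads [c * (2c + 2) <= 2 * (2 ^ c) ^ 2], which follows from
     [c < 2 ^ c]. *)
  exists c.*2.+1 => k /subnKC <-; elim: (k - _) => [|m IHm].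
    have := ltn_expl c (isT : 1 < 2); rewrite addn0 expnS -addnn expnD.
    by set x := 2 ^ c => ?; nia.
  by rewrite addnS expnS; nia.
(* The constant is chosen so that its product with [k + 1] dominates the exponent
   [M + l * d * (k + 2)] needed below. *)
have [K Kc] := expn_ge_linear (M + 2 * (l * d)).
exists (l ^ K.+1) => n n_ge.
have n_gt0 : 0 < n by apply: leq_trans n_ge; rewrite expn_gt0 ltnW.
have log_gt : K < trunc_log l n by apply: trunc_log_max.
case log_n : (trunc_log l n) log_gt => [//|k]; rewrite ltnS => Kk.
have := trunc_logP l_gt1 n_gt0; have := trunc_log_ltn n l_gt1; rewrite log_n.
move=> n_lt n_ge'; apply: leq_trans (p_mono _ _ n_ge'); apply: leq_trans (p_ge k).
apply: (@leq_trans (2 ^ (M + (l * d) * k.+2))); last first.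
  by rewrite leq_pexp2l //; apply: leq_trans (Kc _ Kk); nia.
rewrite expnD leq_mul // ?(ltnW (ltn_expl _ _)) // -mulnA [d * _]mulnC mulnA !expnM.
have [->|d0] := posnP d; first by [].
rewrite leq_exp2r // -expnM.
apply: leq_trans (ltnW n_lt) _; rewrite expnM leq_exp2r //.
exact: ltnW (ltn_expl _ _).
Qed.

Section Analysis.
Variable R : realType.
Local Open Scope classical_set_scope.
Local Open Scope ring_scope.

Lemma nat_cvgn_ge (f : nat -> nat) : (forall n, (n <= f n)%N) -> f n @[n --> \oo] --> \oo.
Proof.
move=> f_ge; apply/cvgnyPge => m; near=> n.
by apply: leq_trans (f_ge n); near: n; exact: nbhs_infty_ge.
Unshelve. all: by end_near.
Qed.

(** Subsequences are extracted for one index after another; those already convergent stay so. The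
    condition [n <= f n] survives composition and suffices for passing to limits. *)
Lemma bolzano_weierstrass_family (I : finType) (u : I -> nat -> R) :
  (forall i n, 0 <= u i n <= 1) ->
  exists2 f : nat -> nat, (forall n, (n <= f n)%N) &
    forall i, cvgn (u i \o f).
Proof.
move=> u01.
suff [f f_ge f_cvg] : exists2 f : nat -> nat, (forall n, (n <= f n)%N) &
    forall i, i \in enum I -> cvgn (u i \o f).
  by exists f => // i; apply: f_cvg; rewrite mem_enum.
elim: (enum I) => [|i s [f f_ge f_cvg]]; first by exists id.
have [|g /increasing_seqP g_incr g_cvg] := @bolzano_weierstrass R (u i \o f).
  exists 1; split=> [|x x_gt1 n _ /=]; first exact: num_real.
  by have /andP[u_ge0 u_le1] := u01 i (f n); rewrite ger0_norm // (le_trans u_le1) // ltW.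
have g_ge n : (n <= g n)%N.
  by elim: n => // n IHn; apply: leq_ltn_trans IHn _; have := g_incr n; rewrite ltEnat.
exists (f \o g) => [n|j]; first exact: leq_trans (f_ge _).
rewrite inE => /orP[/eqP ->|js]; first exact: g_cvg.
apply/cvg_ex; exists (limn (u j \o f)).
exact: (cvg_comp _ _ (nat_cvgn_ge g_ge) (f_cvg j js)).
Qed.

(** * From vanishing frequencies to sub-exponential complexity *)

Section Frequencies.
Variables (A : finType) (theta : random_substitution A) (l : nat).
Hypotheses (l_gt1 : (1 < l)%N)
  (size_realisation : forall a v, v \in theta a -> size v = l)
  (frequency0 : forall a, is_random theta a ->
     forall nu : A -> R, permissible theta nu -> nu a = 0).

Let expl_gt0 k : (0 < l ^ k)%N. Proof. by rewrite expn_gt0 ltnW. Qed.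

(** Otherwise there are exceptional words of arbitrarily high level; along a subsequence their
    frequencies converge to a permissible vector whose value at [r] is at least [e]. *)
Lemma random_letter_rare a r (e : R) : language (subshift theta) [:: a] ->
  is_random theta r -> 0 < e ->
  \forall k \near \oo, forall v, v \in images_iter theta k [:: a] ->
    (count_mem r v)%:R <= e * (l ^ k)%:R.
Proof.
move=> Xa r_random e_gt0; apply: contrapT => not_rare.
have /choice[nv nvP] : forall K, exists nv : nat * seq A, [/\ (K < nv.1)%N,
    nv.2 \in images_iter theta nv.1 [:: a] & e * (l ^ nv.1)%:R < (count_mem r nv.2)%:R].
  move=> K; apply: contrapT => no_nv; apply: not_rare; exists K.+1 => // k /= Kk v va.
  rewrite leNgt; apply/negP => count_gt; apply: no_nv.
  by exists (k, v).
have size_v K : size (nv K).2 = (l ^ (nv K).1)%N.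
  by have [_ /(size_mem_images_iter size_realisation) -> _] := nvP K; rewrite muln1.
pose u c K : R := (count_mem c (nv K).2)%:R / (size (nv K).2)%:R.
have u01 c K : 0 <= u c K <= 1.
  rewrite divr_ge0 ?ler0n //= ler_pdivrMr ?ltr0n ?size_v // mul1r ler_nat.
  by rewrite -size_v count_size.
have [f f_ge u_cvg] := bolzano_weierstrass_family u01.
pose nu c := limn (u c \o f).
have nu_perm : permissible theta nu.
  split=> [c|].
    by apply/andP; split; [apply: limr_ge|apply: limr_le] => //;
      apply: nearW => K /=; have /andP[] := u01 c (f K).
  exists a, (fun K => (nv (f K)).1), (fun K => (nv (f K)).2); split => //.
  - split=> [K|]; first by have [] := nvP (f K); case: (nv _).1.
    apply: nat_cvgn_ge => K; have [fK _ _] := nvP (f K).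
    exact: leq_trans (f_ge K) (ltnW fK).
  - by move=> K; apply/subst_powE; have [] := nvP (f K).
have : e <= nu r.
  apply: limr_ge => //; apply: nearW => K /=; rewrite /u size_v.
  have [_ _ /ltW] := nvP (f K).
  by rewrite ler_pdivlMr ?ltr0n.
by rewrite (frequency0 r_random nu_perm) leNgt e_gt0.
Qed.

Lemma count_random v :
  count (is_random theta) v = (\sum_(r | is_random theta r) count_mem r v)%N.
Proof.
elim: v => [|a v IHv] /=; first by rewrite big1.
rewrite IHv big_split /=; congr addn.
case: (boolP (is_random theta a)) => [a_random|a_det].
  by rewrite (bigD1 a) //= eqxx big1 // => r /andP[_ /negPf]; rewrite eq_sym => ->.
by rewrite big1 // => r r_random; case: eqP a_det r_random => // -> /negPf ->.
Qed.

Lemma random_letters_rare (e : R) : 0 < e ->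
  \forall k \near \oo, forall v, v \in supertiles theta k ->
    (count (is_random theta) v)%:R <= e * (l ^ k)%:R.
Proof.
move=> e_gt0; pose N : R := #|A|.+1%:R.
have N_gt0 : 0 < N by rewrite ltr0n.
(* The finitely many pairs of letters share one threshold, and [e] is divided among the random
   letters. *)
have : \forall k \near \oo, forall ar : A * A,
    language (subshift theta) [:: ar.1] -> is_random theta ar.2 ->
    forall v, v \in images_iter theta k [:: ar.1] ->
    (count_mem ar.2 v)%:R <= e / N * (l ^ k)%:R.
  apply: filter_forall => -[a r] /=.
  have [Xa|nXa] := pselect (language (subshift theta) [:: a]); last exact: nearW.
  case: (boolP (is_random theta r)) => [r_random|_]; last exact: nearW.
  by apply: filterS (random_letter_rare Xa r_random (divr_gt0 e_gt0 N_gt0)) => k H _ _.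
apply: filterS => k rare v /supertilesP[a Xa va].
rewrite count_random natr_sum.
apply: (@le_trans _ _ (\sum_(r | is_random theta r) (e / N * (l ^ k)%:R))).
  by apply: ler_sum => r r_random; exact: (rare (a, r)).
rewrite sumr_const -[leLHS]mulr_natr mulrAC ler_pM2r ?ltr0n // mulrAC ler_pdivrMr //.
rewrite ler_pM2l // ler_nat.
exact: leq_trans (max_card _) (leqnSn _).
Qed.

(** From level [m] to [m + 1] the logarithm grows by at most [(e / D) * l ^ m * ln D], which is
    below [e * l ^ m]; since [2 * l ^ m <= l ^ m.+1], the bound reproduces itself. *)
Lemma supertiles_subexponential (e : R) : 0 < e ->
  exists B : R, \forall k \near \oo,
    (size (supertiles theta k))%:R <= expR (B + e * (l ^ k)%:R).
Proof.
move=> e_gt0; pose D : R := (\max_a #|` theta a|).+1%:R.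
have D_gt0 : 0 < D by rewrite ltr0n.
have [K _ rare] := random_letters_rare (divr_gt0 e_gt0 D_gt0).
(* [B] covers the starting level [K] through [B <= expR B]. *)
pose B : R := (size (supertiles theta K))%:R; exists B; exists K => // k /= /subnKC <-.
elim: (k - K)%N => {k} [|k IHk].
  rewrite addn0; apply: (@le_trans _ _ (expR B)).
    by apply: le_trans (expR_ge1Dx _); rewrite lerDr.
  by rewrite ler_expR lerDl mulr_ge0 // ltW.
rewrite addnS; set m := (K + k)%N in IHk *.
pose c := Num.truncn (e / D * (l ^ m)%:R).
have rhs_ge0 : 0 <= e / D * (l ^ m)%:R by rewrite mulr_ge0 // divr_ge0 // ltW.
have /size_supertilesS size_le v : v \in supertiles theta m -> (count (is_random theta) v <= c)%N.
  by rewrite truncn_ge_nat //; apply: rare; rewrite /= leq_addr.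
apply: (@le_trans _ _ (expR (B + e * (l ^ m)%:R) * expR (e * (l ^ m)%:R))).
  apply: (@le_trans _ _ ((size (supertiles theta m))%:R * D ^+ c)).
    by rewrite -natrX -natrM ler_nat.
  apply: ler_pM; rewrite ?exprn_ge0 ?ler0n //.
  apply: (@le_trans _ _ (expR D ^+ c)).
    by rewrite lerXn2r ?nnegrE ?expR_ge0 ?ltW //; apply: lt_le_trans (expR_ge1Dx _); lra.
  rewrite -expRM_natr ler_expR.
  have : c%:R <= e / D * (l ^ m)%:R by rewrite truncn_le.
  rewrite -(ler_pM2l D_gt0) => /le_trans -> //.
  by rewrite mulrA [D * _]mulrC divfK ?gt_eqF.
rewrite -expRD ler_expR -addrA lerD2l -mulrDr ler_pM2l // -natrD ler_nat expnS.
by rewrite addnn -mul2n leq_mul2r l_gt1 orbT.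
Qed.

Lemma complexity_subexponential :
  ln (complexity (subshift theta) n)%:R / n%:R @[n --> \oo] --> (0 : R).
Proof.
set p := complexity _; apply/cvgrPdist_le => e e_gt0.
have l_gt0 : 0 < l%:R :> R by rewrite ltr0n ltnW.
(* The estimate will be [3 * d * l ^ k + B'] with [l ^ k <= l * n]: this [d] makes the first term at
   most [e / 2 * n], and large [n] bounds [B'] likewise. *)
pose d : R := e / (6 * l%:R).
have d_gt0 : 0 < d by rewrite divr_gt0 // mulr_gt0.
have [B [K _ size_le]] := supertiles_subexponential d_gt0.
pose B' := 2 * B - ln d.
near=> n.
have n_gt0 : (0 < n)%N by near: n; exact: nbhs_infty_gt.
have n_gt0' : 0 < n%:R :> R by rewrite ltr0n.
have ln_ge0 : 0 <= ln (p n)%:R :> R.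
  by case: (p n) => [|m]; [rewrite ln0|rewrite ln_ge0 // ler1n].
rewrite sub0r normrN ger0_norm ?divr_ge0 // ler_pdivrMr //.
(* The logarithm of 0 is 0 by convention. *)
have [->|p_gt0] := posnP (p n); first by rewrite ln0 // mulr_ge0 // ltW.
pose k := (trunc_log l n).+1.
have n_lt : (n < l ^ k)%N by exact: trunc_log_ltn.
have lk_le : (l ^ k)%:R <= l%:R * n%:R :> R.
  by rewrite -natrM ler_nat expnS leq_mul2l trunc_logP ?orbT.
have Kk : (K <= k)%N.
  rewrite ltnW // -(ltn_exp2l _ _ l_gt1); apply: leq_ltn_trans n_lt.
  by near: n; exact: nbhs_infty_ge.
pose y : R := (l ^ k)%:R.
(* The number [l ^ k] of offsets is absorbed too, by [d * y <= expR (d * y)]; with the two supertile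
   factors this gives the coefficient 3. *)
have y_le : y <= expR (d * y - ln d).
  rewrite expRD expRN lnK ?posrE // ler_pdivlMr //.
  by apply: le_trans (expR_ge1Dx _); rewrite mulrC lerDr.
have p_le : (p n)%:R <= expR (3 * (d * y) + B').
  apply: (@le_trans _ _ (y * (size (supertiles theta k))%:R ^+ 2)).
    rewrite -natrX -natrM ler_nat.
    exact: complexity_upper_bound l_gt1 size_realisation _ _ (ltnW n_lt).
  have -> : 3 * (d * y) + B' = (d * y - ln d) + (B + d * y) * 2 by rewrite /B'; ring.
  rewrite expRD expRM_natr ler_pM // ?exprn_ge0 //.
  by rewrite lerXn2r ?nnegrE ?expR_ge0 //; exact: size_le.
apply: (@le_trans _ _ (3 * (d * y) + B')).
  by rewrite -[leRHS]expRK ler_ln ?posrE ?expR_gt0 ?ltr0n.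
have dl : 6 * (d * l%:R) = e by rewrite /d; field; rewrite gt_eqF.
have B'_le : B' <= e / 2 * n%:R.
  rewrite mulrC -ler_pdivrMr ?divr_gt0 //; near: n; exact: nbhs_infty_ger.
have : d * y <= d * (l%:R * n%:R) by rewrite ler_pM2l.
rewrite -dl in B'_le *; nra.
Unshelve. all: by end_near.
Qed.

End Frequencies.
End Analysis.

Theorem proposition5p3 (R : realType) (A : finType)
    (theta : random_substitution A)
    (hlen : constant_length theta)
    (hfreq : forall a : A, (2 <= #|` theta a|)%N ->
       forall nu : A -> R, permissible theta nu -> nu a = 0%R)
    (hrep : exists b : A, (2 <= #|` theta b|)%N /\
       exists2 v : seq A, v \in theta b & (2 <= count_mem b v)%N) :
  intermediate_growth R (complexity (subshift theta)).
Proof.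
have [l l_gt1 size_realisation] := hlen.
have [b [b_random [v vb count_v]]] := hrep.
split; last exact: complexity_subexponential l_gt1 size_realisation hfreq.
move=> d; apply/cvgryPge => M.
(* The real bound [M] is replaced by a natural number above it. *)
have [N p_ge] := superpolynomial_of_double_exponential (Num.truncn M).+1 d l_gt1
  (@leq_complexity _ (subshift theta))
  (fun k => complexity_lower_bound l_gt1 size_realisation k b_random vb count_v).
near=> n.
have n_gt0 : 0 < n by near: n; exact: nbhs_infty_gt.
rewrite ler_pdivlMr ?exprn_gt0 ?ltr0n //.
apply: (@le_trans _ _ (((Num.truncn M).+1 * n ^ d)%N%:R)%R).
  rewrite natrM natrX ler_wpM2r ?exprn_ge0 //; apply/ltW; exact: truncnS_gt.
by rewrite ler_nat p_ge //; near: n; exact: nbhs_infty_ge.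
Unshelve. all: by end_near.
Qed.
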